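(* Let $\Gamma=\{\gamma_1,\dots,\gamma_{|\Gamma|}\}$ be a finite group acting on the state space $\mathbb{R}^n$ by maps $\gamma_\rho$, let $x_{i+1}=g(x_i)$ be a $\Gamma$-equivariant discrete-time system, and let $k$ be a kernel of the form $k(x,y)=\Psi(x)\Psi(y)^*$, where $\Psi(x)=(\psi_1(x),\dots,\psi_N(x))$ is the row vector of dictionary functions (observables). Then, due to the properties of inner products, $$k(\gamma_\rho x,\gamma_\rho y)=k(x,y)\qquad\text{for all }\gamma\in\Gamma .$$ Let the $M$ snapshot pairs respect the symmetry and be ordered by group element: starting from base pairs $(x_a,y_a)$, $1\le a\le M/|\Gamma|$, the pair with index $(j,a)$ is $(\gamma_{j,\rho}x_a,\gamma_{j,\rho}y_a)$, $1\le j\le|\Gamma|$ (blocks indexed by $j$). Let $\hat G$ and $\hat A$ be the $M\times M$ kernel DMD matrices $$\hat G_{(j,a),(l,b)}=k(\gamma_{j,\rho}x_a,\gamma_{l,\rho}x_b),\qquad \hat A_{(j,a),(l,b)}=k(\gamma_{j,\rho}x_a,\gamma_{l,\rho}y_b).$$ Then for every $\gamma\in\Gamma$ $$\mathbf{P}_\gamma\hat G=\hat G\,\mathbf{P}_\gamma,\qquad \mathbf{P}_\gamma\hat A=\hat A\,\mathbf{P}_\gamma .$$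
   Context: The set of actions $\{\gamma_\rho:\gamma\in\Gamma\}$ is a group isomorphic to $\Gamma$, with $(\gamma\sigma)_\rho=\gamma_\rho\sigma_\rho$. The system is $\Gamma$-equivariant if $g(\gamma_\rho x)=\gamma_\rho g(x)$ for all states $x$ and all $\gamma\in\Gamma$. A snapshot pair $(x,y)$ consists of two consecutive states, $y=g(x)$. For $\gamma\in\Gamma$, $P_\gamma$ is the $|\Gamma|\times|\Gamma|$ permutation matrix determined by $P_\gamma(\gamma_1,\dots,\gamma_{|\Gamma|})^T=(\gamma\gamma_1,\dots,\gamma\gamma_{|\Gamma|})^T$; by Cayley's theorem these permutations form a group isomorphic to $\Gamma$. $\mathbf{P}_\gamma=P_\gamma\otimes I$, with $I$ the identity matrix of size $M/|\Gamma|$, so $\mathbf{P}_\gamma^*=\mathbf{P}_\gamma^{-1}$. $^*$ denotes conjugate transpose.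
   Formalization: Added assumption: for every γ there is a unitary N×N matrix U with Ψ(γ_ρ x) = Ψ(x)U for all x; for arbitrary Ψ the claim fails (Z/2 acting by x ↦ −x, Ψ(x) = 1+x, g = id). *)

(* Defs.v *)
From HB Require Import structures.
From mathcomp Require Import all_boot all_order all_fingroup all_algebra.
From mathcomp Require Import reals.
From mathcomp Require Export complex mxtens.

Set Implicit Arguments.
Unset Strict Implicit.
Unset Printing Implicit Defensive.

Import Order.TTheory GRing.Theory Num.Theory.
Local Open Scope ring_scope.
Local Open Scope sesquilinear_scope.
Local Open Scope complex_scope.

(* MathComp's own actions are right actions, whereas (g h)_rho = g_rho h_rho
   is a left action. Injectivity of rho says that the set of maps g_rho is a
   group isomorphic to the whole of gT. *)
Definition faithful_left_action (gT : finGroupType) (S : Type)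
    (rho : gT -> S -> S) : Prop :=
  [/\ forall s, rho 1%g s = s,
      forall a b s, rho (a * b)%g s = rho a (rho b s)
    & injective rho].

Definition equivariant (gT : finGroupType) (S : Type)
    (rho : gT -> S -> S) (g : S -> S) : Prop :=
  forall a s, g (rho a s) = rho a (g s).

Definition dict_kernel (R : realType) (S : Type) (N : nat)
    (Psi : S -> 'rV[R[i]]_N) (s t : S) : R[i] :=
  (Psi s *m (Psi t)^t*) 0 0.

(* The group acts on the feature space C^N by isometries: every a acts on the
   dictionary through a unitary matrix (for instance a permutation of the
   observables). Without a condition of this kind Psi(x) Psi(y)^* need not be
   invariant: take Z/2 acting on R by x |-> -x and the one-element dictionary
   1 + x. *)
Definition unitary_dictionary (R : realType) (gT : finGroupType) (S : Type)
    (rho : gT -> S -> S) (N : nat) (Psi : S -> 'rV[R[i]]_N) : Prop :=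
  forall a, exists2 U : 'M[R[i]]_N,
    U \is unitarymx & forall s, Psi (rho a s) = Psi s *m U.

(* Row j has its only nonzero entry in the column l with gam l = a * gam j, so
   that applying this matrix to the column (gam_1, ..., gam_|gT|)^T yields
   (a gam_1, ..., a gam_|gT|)^T. *)
Definition cayley_mx (R : realType) (gT : finGroupType)
    (gam : 'I_#|gT| -> gT) (a : gT) : 'M[R[i]]_#|gT| :=
  \matrix_(j, l) (gam l == (a * gam j)%g)%:R.

Lemma cayley_mx_perm (R : realType) (gT : finGroupType)
    (gam : 'I_#|gT| -> gT) (gam_bij : bijective gam) (a : gT) :
  exists2 s : 'S_#|gT|, cayley_mx R gam a = perm_mx s &
    forall j, gam (s j) = (a * gam j)%g.
Proof.
have [del gamK delK] := gam_bij.
have inj_s : injective (fun j => del (a * gam j)%g).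
  move=> i j /(congr1 gam); rewrite !delK => /mulgI.
  exact: (can_inj gamK).
exists (perm inj_s) => [|j]; last by rewrite permE delK.
apply/matrixP => j l; rewrite !mxE permE.
by rewrite -(inj_eq (can_inj gamK)) delK eq_sym.
Qed.

Definition block_cayley_mx (R : realType) (gT : finGroupType)
    (gam : 'I_#|gT| -> gT) (m : nat) (a : gT) : 'M[R[i]]_(#|gT| * m) :=
  cayley_mx R gam a *t (1%:M : 'M[R[i]]_m).

(* Entry number p = (j, a), under the indexing of Kronecker products, is the
   translate by gam j of the a-th base state. *)
Definition symmetric_data (gT : finGroupType) (S : Type) (rho : gT -> S -> S)
    (gam : 'I_#|gT| -> gT) (m : nat) (x : 'I_m -> S)
    (p : 'I_(#|gT| * m)) : S :=
  rho (gam (mxtens_unindex p).1) (x (mxtens_unindex p).2).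

Definition kernel_mx (R : realType) (S : Type) (k : S -> S -> R[i]) (M : nat)
    (X Y : 'I_M -> S) : 'M[R[i]]_M :=
  \matrix_(p, q) k (X p) (Y q).

(* Main.v *)
Require Import Defs.
From mathcomp Require Import all_boot all_order all_fingroup all_algebra.
From mathcomp Require Import reals.

Local Open Scope ring_scope.
Local Open Scope complex_scope.

(** Since rho a o rho (gam j) = rho (a * gam j), the matrix P_a tensor 1
    permutes the indices of the data in the way that rho a permutes the data.
    The kernel is invariant under rho a, so each kernel matrix is invariant
    under this simultaneous permutation of its rows and columns, and this is
    the same as commuting with P_a tensor 1. *)

Import GRing.Theory.
Local Open Scope sesquilinear_scope.

(** Left multiplication by [perm_mx t] permutes rows by [t], and right multiplication permutes
    columns by [t^-1]. Entrywise the claim is [K (t i) j = K i (t^-1 j)], the hypothesis at column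
    [t^-1 j]. *)
Lemma perm_mx_comm (R : pzRingType) (n : nat) (t : 'S_n) (K : 'M[R]_n) :
  (forall i j, K (t i) (t j) = K i j) -> perm_mx t *m K = K *m perm_mx t.
Proof.
move=> Kt; rewrite -row_permE -[t in RHS]invgK -col_permE.
by apply/matrixP => i j; rewrite !mxE -[RHS]Kt permKV.
Qed.

Lemma tens_perm_mx1 (R : pzRingType) (n m : nat) (s : 'S_n) :
  exists2 t : 'S_(n * m), perm_mx s *t (1%:M : 'M[R]_m) = perm_mx t &
    forall p, mxtens_unindex (t p) =
      (s (mxtens_unindex p).1, (mxtens_unindex p).2).
Proof.
pose f (p : 'I_(n * m)) :=
  mxtens_index (s (mxtens_unindex p).1, (mxtens_unindex p).2).
have f_inj : injective f.
  move=> p q /(can_inj (@mxtens_indexK n m)) /eqP.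
  rewrite xpair_eqE (inj_eq perm_inj) -xpair_eqE -!surjective_pairing => /eqP.
  exact: can_inj (@mxtens_unindexK n m) p q.
exists (perm f_inj) => [|p]; last by rewrite permE mxtens_indexK.
apply/matrixP => p q; rewrite !mxE permE.
(* Compared as pairs, [f p] and [q] agree iff both coordinates do, so the 0-1 entry on the right is
   the product of the entries of [perm_mx s] and of the identity. *)
rewrite -[in RHS](inj_eq (can_inj (@mxtens_unindexK n m))) mxtens_indexK.
by case: (mxtens_unindex q) => q1 q2; rewrite xpair_eqE -natrM mulnb.
Qed.

(** The unitary factor cancels inside [Psi s *m U *m U^t* *m (Psi t)^t*]. *)
Lemma dict_kernel_invariant (R : realType) (gT : finGroupType) (S : Type)
    (rho : gT -> S -> S) (N : nat) (Psi : S -> 'rV[R[i]]_N) :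
  unitary_dictionary rho Psi ->
  forall a s t, dict_kernel Psi (rho a s) (rho a t) = dict_kernel Psi s t.
Proof.
move=> Psi_unitary a s t; have [U /unitarymxP UU1 PsiU] := Psi_unitary a.
rewrite /dict_kernel !PsiU trmx_mul map_mxM mulmxA.
by rewrite -(mulmxA (Psi s)) UU1 mulmx1.
Qed.

(** Allowing two base families covers both kernel DMD matrices: [G] is the case where they coincide,
    [A] pairs states with their successors. *)
Lemma block_cayley_mx_comm (R : realType) (gT : finGroupType) (S : Type)
    (rho : gT -> S -> S) (gam : 'I_#|gT| -> gT) (k : S -> S -> R[i])
    (m : nat) (x y : 'I_m -> S) (a : gT) :
  (forall b c s, rho (b * c)%g s = rho b (rho c s)) -> bijective gam ->
  (forall s t, k (rho a s) (rho a t) = k s t) ->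
  let K := kernel_mx k (symmetric_data rho gam x) (symmetric_data rho gam y) in
  block_cayley_mx R gam m a *m K = K *m block_cayley_mx R gam m a.
Proof.
move=> rhoM gam_bij k_inv K.
have [s Ps gam_s] := cayley_mx_perm R gam_bij a.
have [t Pt t_s] := tens_perm_mx1 R[i] _ m s.
rewrite /block_cayley_mx Ps Pt; apply: perm_mx_comm => p q.
(* The datum at [t p] is [rho a] of the datum at [p], and likewise for [q], so both arguments of [k]
   are moved by the same [a]. *)
by rewrite !mxE /symmetric_data !t_s /= !gam_s !rhoM k_inv.
Qed.

Theorem mainTheorem5 (R : realType) (n : nat) (gT : finGroupType)
  (rho : gT -> 'cV[R]_n -> 'cV[R]_n)
  (rho_action : faithful_left_action rho)
  (g : 'cV[R]_n -> 'cV[R]_n)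
  (g_equivariant : equivariant rho g)
  (N : nat) (Psi : 'cV[R]_n -> 'rV[R[i]]_N)
  (Psi_unitary : unitary_dictionary rho Psi)
  (k : 'cV[R]_n -> 'cV[R]_n -> R[i])
  (k_def : forall x y, k x y = dict_kernel Psi x y)
  (gam : 'I_#|gT| -> gT) (gam_bij : bijective gam)
  (m : nat) (x y : 'I_m -> 'cV[R]_n)
  (snapshots : forall a, y a = g (x a)) :
  (forall (a : gT) (s t : 'cV[R]_n), k (rho a s) (rho a t) = k s t) /\
  (forall a : gT,
     let P := block_cayley_mx R gam m a in
     let G := kernel_mx k (symmetric_data rho gam x) (symmetric_data rho gam x) in
     let A := kernel_mx k (symmetric_data rho gam x) (symmetric_data rho gam y) in
     P *m G = G *m P /\ P *m A = A *m P).
Proof.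
have k_inv a s t : k (rho a s) (rho a t) = k s t.
  by rewrite !k_def dict_kernel_invariant.
have [_ rhoM _] := rho_action.
by split=> // a; split; apply: block_cayley_mx_comm => //.
Qed.
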